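(* Let $z\in\{-1,0,1\}^{\mathbb{N}^*}$ be such that $$\liminf_{N\to\infty}\frac1N\sum_{n\le N}z(n)^2>0,$$ and suppose moreover that: (a) $z$ is quasi-generic for some shift-invariant Borel probability measure $\widetilde\nu$ on $\{-1,0,1\}^{\mathbb{N}^*}$; (b) $H:=h_{top}(\mathrm{supp}(\widetilde\nu))>0$; (c) there exist integers $q\ge 2$ and $b\ge1$ such that, for all $m\ge1$, the number of ergodic components of the action of $S^{q^m}$ on $(\{-1,0,1\}^{\mathbb{N}^*},\widetilde\nu)$ is bounded by $b$. Then for every $\varepsilon>0$ there exists a Toeplitz sequence $t=(t_n)_{n\in\mathbb{N}^*}\in\{-1,0,1\}^{\mathbb{N}^*}$ such that $$h_{top}(t)\ge(1-\varepsilon)H\quad\text{and}\quad \liminf_{N\to\infty}\frac1N\sum_{n\le N}t_n\,z(n)>0.$$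
   Context: $\mathbb{N}^*=\{1,2,3,\dots\}$; sums $\sum_{n\le N}$ are over $1\le n\le N$; logarithms are to base $2$. For a finite alphabet $A$, $S$ is the left shift on $A^{\mathbb{N}^*}$, $(Sw)(n)=w(n+1)$, and $A^{\mathbb{N}^*}$ has the product topology. A point $w\in A^{\mathbb{N}^*}$ is quasi-generic for a probability measure $\nu$ if $\frac1{N_k}\sum_{n\le N_k}\delta_{S^nw}\to\nu$ weakly along some increasing sequence $(N_k)$. A block is an element of $A^n$ for some $n\ge1$. For a shift-invariant probability measure $\nu$ on $A^{\mathbb{N}^*}$, $\nu(B)$ for a block $B\in A^n$ denotes the measure of the cylinder of sequences starting with $B$, and $$h_{top}(\mathrm{supp}(\nu)):=\lim_{n\to\infty}\frac1n\log\left|\{B\in A^n:\nu(B)>0\}\right|.$$ For a sequence $w$, $h_{top}(w):=\lim_{n\to\infty}\frac1n\log p_n(w)$, where $p_n(w)$ is the number of distinct blocks of length $n$ appearing in $w$. A sequence $t\in A^{\mathbb{N}^*}$ is Toeplitz if for each $a\in\mathbb{N}^*$ there exists $r_a\in\mathbb{N}^*$ such that $t(a)=t(a+kr_a)$ for every $k\in\mathbb{N}^*$. *)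

(* Defs.v *)
From HB Require Import structures.
From mathcomp Require Export all_boot all_order all_algebra.
From mathcomp Require Export all_classical all_reals all_analysis.
Export Order.TTheory GRing.Theory Num.Theory numFieldNormedType.Exports.

Set Implicit Arguments.
Unset Strict Implicit.
Unset Printing Implicit Defensive.

Local Open Scope classical_set_scope.
Local Open Scope ring_scope.

Definition sgn : Type := seq_sub [:: -1; 0; 1 : int].

HB.instance Definition _ := Finite.on sgn.

Fact sgn0_proof : (0 : int) \in [:: -1; 0; 1 : int].
Proof. by []. Qed.

HB.instance Definition _ := isPointed.Build sgn (SeqSub sgn0_proof).
HB.instance Definition _ := hasNbhs.Build sgn principal_filter.
HB.instance Definition _ := Discrete_ofNbhs.Build sgn erefl.

Definition sgnR {R : realType} (a : sgn) : R := (val a)%:~R.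

(* Positions are shifted by one: [w n] is the letter usually written w(n+1),
   so that sequences indexed by {1, 2, ...} become functions on [nat].  The
   topology is the product of the discrete ones. *)
Definition sgnseq : Type := {ptws nat -> sgn}.

HB.instance Definition _ := Topological.copy sgnseq {ptws nat -> sgn}.
HB.instance Definition _ := Pointed.copy sgnseq (nat -> sgn).

Definition borel_sgnseq : Type := g_sigma_algebraType (@open sgnseq).

HB.instance Definition _ := Measurable.on borel_sgnseq.

Definition shift (w : borel_sgnseq) : borel_sgnseq := fun n => w n.+1.

Definition toeplitz {A : Type} (t : nat -> A) :=
  forall a, exists2 r, (0 < r)%N & forall k, (0 < k)%N -> t a = t (a + k * r)%N.

Section Dynamics.
Context {d : measure_display} {X : measurableType d} {R : realType}.
Implicit Types (T : X -> X) (mu nu : probability X R).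

Definition invariant_measure T mu :=
  forall A, measurable A -> mu (T @^-1` A) = mu A.

Definition ergodic T mu :=
  invariant_measure T mu /\
  forall A, measurable A -> T @^-1` A = A -> mu A = 0%E \/ mu A = 1%E.

(* The ergodic decomposition of [nu] under [T] is a convex combination of
   exactly [k] ergodic measures.  Distinctness is stated on measurable sets
   because the values of a [probability] elsewhere are irrelevant. *)
Definition has_ergodic_components T nu (k : nat) :=
  exists (mu : 'I_k -> probability X R) (c : 'I_k -> R),
    [/\ forall i, ergodic T (mu i),
        forall i j, (forall A, measurable A -> mu i A = mu j A) -> i = j,
        forall i, 0 < c i,
        \sum_i c i = 1 &
        forall A, measurable A -> nu A = (\sum_i (c i)%:E * mu i A)%E].

End Dynamics.

Section Sequences.
Context {R : realType}.

Definition log2 (x : R) : R := ln x / ln 2.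

Definition weak_cvg (mu : nat -> {measure set borel_sgnseq -> \bar R})
    (nu : {measure set borel_sgnseq -> \bar R}) :=
  forall f : sgnseq -> R, continuous f ->
    Rintegral (mu k) setT f @[k --> \oo] --> Rintegral nu setT f.

Definition empirical (w : sgnseq) (N : nat) :
    {measure set borel_sgnseq -> \bar R} :=
  mscale (N%:R^-1)%:nng
    (msum (fun n => \d_(iter n.+1 shift w)) N).

Definition quasi_generic (w : sgnseq) (nu : probability borel_sgnseq R) :=
  exists N : nat -> nat, {homo N : i j / (i < j)%N} /\
    weak_cvg (fun k => empirical w (N k)) nu.

Definition cylinder n (B : n.-tuple sgn) : set borel_sgnseq :=
  [set w | forall i : 'I_n, w i = tnth B i].

Definition htop_supp (nu : probability borel_sgnseq R) : R :=
  limn (fun n =>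
    log2 #|[pred B : n.-tuple sgn | (0 < nu (cylinder B))%E]|%:R / n%:R).

Definition complexity (w : sgnseq) (n : nat) : nat :=
  #|[pred B : n.-tuple sgn |
     `[< exists i, forall j : 'I_n, w (i + j)%N = tnth B j >]]|.

Definition htop (w : sgnseq) : R :=
  limn (fun n => log2 (complexity w n)%:R / n%:R).

End Sequences.

Arguments htop R w : clear implicits.

(* Main.v *)
(* Fix scales 1 <= M_0 | M_1 | M_2 | ... growing very fast.  The Toeplitz
   sequence copies z on [0, M_j) with period M_{j+1}: its n-th letter is
   z(n mod M_{j+1}), where j is least with n mod M_{j+1} < M_j.  It differs from
   z on a set whose density up to every N is at most sum_j M_j / M_{j+1}, which
   is as small as we like; so its correlation with z stays close to the average
   of z^2.

   Let n = M_k^2.  Each block B of length n with nu(B) > 0 occurs in z with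
   positive frequency along some sequence of lengths.  If M_{k+1} is chosen
   after these frequencies, then B occurs in z at a position whose window meets
   no copy coming from a scale j >= k.  The copies from the scales j < k are
   periodic of period M_k, so B is determined by the position modulo M_k, the
   block of the Toeplitz sequence there, and the few letters lost under these
   copies.  Hence the Toeplitz sequence has almost as many blocks of length n as
   the support of nu. *)
Require Import Defs.
From mathcomp Require Import zify lra.

Local Open Scope classical_set_scope.
Local Open Scope ring_scope.

(** * Residue counts and the choice of scales *)

Lemma count_residues_lt m a r s : (0 < m)%N ->
  (\sum_(r <= x < r + s * m) (x %% m < a) <= s * a)%N.
Proof.
(* Sliding a window of length [m] by one trades [r'] for the congruent [r' + m], so every window
   counts like [[0, m)]. *)
move=> m0; have one r' : (\sum_(r' <= x < r' + m) (x %% m < a) <= a)%N.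
  elim: r' => [|r' IH].
    rewrite add0n; apply: (@leq_trans (\sum_(0 <= x < m) (x < a))).
      rewrite !big_nat; apply: leq_sum => x /andP[_ xm].
      by rewrite modn_small.
    elim: (m) => [|k IH]; first by rewrite big_nil.
    rewrite big_nat_recr //=; case: ltnP => [ka|_]; last by rewrite addn0.
    rewrite addn1; apply: leq_ltn_trans ka.
    rewrite -[leqRHS]subn0 -[leqRHS]muln1 -sum_nat_const_nat.
    by apply: leq_sum => x _; case: (_ < _)%N.
  apply: leq_trans IH; case: m m0 => // m _.
  rewrite !addnS (big_nat_recr _ _ _ _) /=; last lia.
  rewrite [leqRHS]big_ltn; last lia.
  rewrite addnC leq_add2r.
  by rewrite addSn -addnS modnDr.
elim: s => [|s IH]; first by rewrite mul0n addn0 big_geq.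
rewrite (@big_cat_nat _ _ _ (r + s * m)) /=; [|lia|lia].
rewrite [leqRHS]mulSn addnC leq_add //.
by rewrite (_ : (r + s.+1 * m = r + s * m + m)%N); [exact: one|lia].
Qed.

(** Leaving out the first period turns the ceiling of N / m into a floor; the density bounds built
    on it then hold for every N, not just in the limit. *)
Lemma count_new_residues_lt m a N : (0 < m)%N ->
  (\sum_(x < N) ((m <= x) && (x %% m < a)) <= N %/ m * a)%N.
Proof.
move=> m0; rewrite -(big_mkord xpredT
  (fun x => ((m <= x) && (x %% m < a))%N : nat)).
have [Nm|mN] := ltnP N m.
  rewrite big_nat big1 // => x /andP[_ xN].
  by rewrite leqNgt (ltn_trans xN Nm).
apply: leq_trans (count_residues_lt m a m (N %/ m) m0).
rewrite (@big_cat_nat _ _ _ m) //= big_nat big1 ?add0n; last first.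
  by move=> x /andP[_ xm]; rewrite leqNgt xm.
rewrite [leqRHS](@big_cat_nat _ _ _ N) //=; last first.
  by rewrite -mulSn ltnW // ltn_ceil.
by apply: leq_trans (leq_addr _ _); apply: leq_sum => x _; case: (m <= x)%N.
Qed.

(** The budget shared by the scales: scale j may spoil a fraction 1 / 2^(j+1) of the positions. *)
Lemma sum_divn_exp2_le N m : (\sum_(j < m) N %/ 2 ^ j.+1 <= N)%N.
Proof.
suff: (\sum_(j < m) N %/ 2 ^ j.+1 + N %/ 2 ^ m <= N)%N.
  by apply: leq_trans; exact: leq_addr.
elim: m => [|m IH]; first by rewrite big_ord0 divn1.
rewrite big_ord_recr /= -addnA; apply: leq_trans IH; rewrite leq_add2l.
by rewrite addnn -muln2 expnSr divnMA leq_trunc_div.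
Qed.

Lemma fast_scales (G : nat -> nat) : exists M : nat -> nat,
  [/\ forall j, (j < M j)%N, forall j, (M j %| M j.+1)%N &
      forall i j, (i <= j)%N -> (2 ^ j.+1 * G (M i) * M j <= M j.+1)%N].
Proof.
(* The sum dominates [G (M i)] for all i <= j at once, as M i <= M j; the successor keeps the factor
   at least 2, so [M] grows strictly. *)
pose mult j m := (2 ^ j.+1 * (\sum_(i < m.+1) G i).+1)%N.
pose M := fix M j := if j is j'.+1 then (mult j' (M j') * M j')%N else 1%N.
have MS j : M j.+1 = (mult j (M j) * M j)%N by [].
have mult_gt1 j m : (1 < mult j m)%N.
  rewrite /mult -[1%N]/(1 * 1)%N; apply: (@leq_trans (2 * 1)) => //.
  apply: leq_mul => //; first by rewrite expnS leq_pmulr // expn_gt0.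
have Mgt j : (j < M j)%N.
  elim: j => // j IH; rewrite MS.
  apply: (leq_ltn_trans IH); rewrite ltn_Pmull ?mult_gt1 //.
  exact: leq_ltn_trans IH.
exists M; split => //.
- by move=> j; rewrite MS dvdn_mull.
- move=> i j ij; rewrite MS leq_mul // /mult leq_mul //.
  have Mij : (M i <= M j)%N.
    apply: (@homo_leq _ M leq) => //; first exact: leq_trans.
    by move=> n; rewrite MS leq_pmull // ltnW.
  rewrite ltnW // ltnS (bigD1 (inord (M i))) //= inordK ?ltnS //.
  by rewrite leq_addr.
Qed.

(** Composing any sequence with [f] gives a Toeplitz sequence. A position below the period of its
    level is its own residue, so only positions with [M j.+1 <= n] can move. *)
Lemma toeplitz_fold (M : nat -> nat) :
  (forall j, (j < M j)%N) -> (forall j, (M j %| M j.+1)%N) ->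
  exists f : nat -> nat,
    (forall n, exists2 r, (0 < r)%N & forall k, f (n + k * r)%N = f n) /\
    forall n, f n = n \/
      exists j, (M j.+1 <= n)%N && (n %% M j.+1 < M j)%N.
Proof.
move=> Mgt Mdvd.
have M0 j : (0 < M j)%N by apply: leq_ltn_trans (Mgt j).
have Mdvdle i j : (i <= j)%N -> (M i %| M j)%N.
  apply: (@homo_leq _ M dvdn) => //; exact: dvdn_trans.
have level_ex n : exists j, (n %% M j.+1 < M j)%N.
  by exists n; apply: leq_ltn_trans (leq_mod _ _) (Mgt n).
(* The least j with n %% M j.+1 < M j is invariant under n |-> n + k * M j.+1,
   because the earlier scales divide M j.+1. *)
exists (fun n => (n %% M (ex_minn (level_ex n)).+1)%N); split=> n; last first.
  case: (ex_minnP (level_ex n)) => j nj _; have [nM|Mn] := ltnP n (M j.+1).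
    by left; rewrite modn_small.
  by right; exists j; rewrite Mn nj.
case: (ex_minnP (level_ex n)) => j nj jmin; exists (M j.+1) => // k.
have modE i : (i <= j)%N -> ((n + k * M j.+1) %% M i.+1 = n %% M i.+1)%N.
  move=> ij; rewrite -modnDmr.
  by have /eqP -> := dvdn_mull k (Mdvdle i.+1 j.+1 ij); rewrite addn0.
case: (ex_minnP (level_ex _)) => i ni imin.
have ij : (i <= j)%N by apply: imin; rewrite modE.
by rewrite modE // (_ : i = j) //; apply/eqP; rewrite eqn_leq ij jmin // -modE.
Qed.

Lemma count_far_residues M k c N : (forall j, (j < M j)%N) ->
  (forall j, (k <= j)%N -> (2 ^ j.+1 * c * M j <= M j.+1)%N) ->
  (c * \sum_(x < N) `[< exists2 j, (k <= j)%N &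
     (M j.+1 <= x)%N && (x %% M j.+1 < M j)%N >] <= N)%N.
Proof.
move=> Mgt Mfast; apply: leq_trans (sum_divn_exp2_le N N).
apply: (@leq_trans (c * \sum_(x < N) \sum_(j < N)
    (k <= j)%N * ((M j.+1 <= x) && (x %% M j.+1 < M j)))%N).
  rewrite leq_mul2l; apply/orP; right; apply: leq_sum => x _.
  case: asboolP => // -[j kj /andP[Mx xM]].
  (* Since j < M j.+1 <= x < N, finitely many scales matter and the sum over j can stop at N. *)
  have jN : (j < N)%N.
    apply: leq_trans (ltn_ord x); apply: leq_trans (ltnW (Mgt j.+1)) _.
    exact: leqW.
  by rewrite (bigD1 (Ordinal jN)) //= kj Mx xM.
rewrite exchange_big /= big_distrr /=; apply: leq_sum => j _.
have [kj|_] := leqP k j; last by rewrite big1 ?muln0 // => x; rewrite mul0n.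
rewrite (eq_bigr _ (fun x _ => mul1n _)).
have Mj0 : (0 < M j.+1)%N by apply: leq_ltn_trans (Mgt _).
rewrite leq_divRL ?expn_gt0 //; apply: leq_trans (leq_trunc_div N (M j.+1)).
apply: leq_trans (leq_mul (leqnn _) (Mfast j kj)).
rewrite [leqRHS](_ : _ = (c * (N %/ M j.+1 * M j) * 2 ^ j.+1)%N); last lia.
by rewrite leq_mul // leq_mul // count_new_residues_lt.
Qed.

(** The length [n] is a multiple of each period involved, so any window of that length splits into
    whole periods, wherever it starts. *)
Lemma count_near_residues M k c r n :
  (forall j, (j < k)%N -> (0 < M j.+1)%N && (M j.+1 %| n)%N) ->
  (forall j, (j < k)%N -> (2 ^ j.+1 * c * M j <= M j.+1)%N) ->
  (c * \sum_(r <= x < r + n) [exists j : 'I_k, x %% M j.+1 < M j] <= n)%N.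
Proof.
move=> Mdvd Mfast; apply: leq_trans (sum_divn_exp2_le n k).
apply: (@leq_trans (c * \sum_(r <= x < r + n) \sum_(j < k)
    (x %% M j.+1 < M j))%N).
  rewrite leq_mul2l; apply/orP; right; apply: leq_sum => x _.
  by case: existsP => // -[j xj]; rewrite (bigD1 j) //= xj.
rewrite exchange_big /= big_distrr /=; apply: leq_sum => j _.
have /andP[Mj0 Mjn] := Mdvd j (ltn_ord j).
have := count_residues_lt (M j.+1) (M j) r (n %/ M j.+1) Mj0.
rewrite divnK // => cnt.
rewrite leq_divRL ?expn_gt0 //; apply: leq_trans (leq_trunc_div n (M j.+1)).
apply: leq_trans (leq_mul (leqnn _) (Mfast j (ltn_ord j))).
rewrite [leqRHS](_ : _ = (c * (n %/ M j.+1 * M j) * 2 ^ j.+1)%N); last lia.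
by rewrite leq_mul // leq_mul.
Qed.

(** * Occurrences of blocks away from a sparse set *)

Definition occurs {A : eqType} (z : nat -> A) n (B : n.-tuple A) i :=
  [forall j : 'I_n, z (i + j)%N == tnth B j].

(** Each marked position lies in at most [n] windows of length [n]. *)
Lemma sum_windows_le (S : nat -> bool) n N :
  (\sum_(i < N) [exists x : 'I_n, S (i + x)] <= n * \sum_(y < N + n) S y)%N.
Proof.
apply: (@leq_trans (\sum_(i < N) \sum_(x < n) S (i + x))%N).
  apply: leq_sum => i _; case: existsP => // -[x Sx].
  by rewrite (bigD1 x) //= Sx.
rewrite exchange_big /= -[leqLHS]/(\sum_(x < n) _)%N.
rewrite -[n in (n * _)%N]card_ord -sum_nat_const; apply: leq_sum => x _.
rewrite -(big_mkord xpredT (fun i => S (i + x)%N : nat)).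
rewrite -(big_mkord xpredT (fun i => S i : nat)).
have -> : (\sum_(0 <= i < N) S (i + x) = \sum_(x <= y < N + x) S y)%N.
  by rewrite -{2}[val x]add0n big_addn addnK.
rewrite [leqRHS](@big_cat_nat _ _ _ x) //=; last by rewrite ltnW // ltn_addl.
apply: leq_trans (leq_addl _ _).
rewrite [leqRHS](@big_cat_nat _ _ _ (N + x)) //= ?leq_addr ?leq_addl //.
by rewrite leq_add2l ltnW.
Qed.

(** A maximum over the finitely many blocks of length n. The constant must depend on n alone,
    because the scales are chosen from it before any block is considered. *)
Lemma uniform_frequency (A : finType) (z : nat -> A)
    (P : forall n, pred (n.-tuple A)) :
  (forall n (B : n.-tuple A), P n B -> exists c : nat, forall N0,
     exists2 N, (N0 <= N)%N & (N <= c * \sum_(i < N) occurs z n B i)%N) ->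
  exists c : nat -> nat, forall n (B : n.-tuple A), P n B -> forall N0,
     exists2 N, (N0 <= N)%N & (N <= c n * \sum_(i < N) occurs z n B i)%N.
Proof.
move=> freq; suff /choice[c cP] n : exists c, forall B : n.-tuple A, P n B ->
    forall N0, exists2 N, (N0 <= N)%N &
      (N <= c * \sum_(i < N) occurs z n B i)%N by exists c.
have /fin_all_exists[c cP] (B : n.-tuple A) : exists c, P n B -> forall N0,
    exists2 N, (N0 <= N)%N & (N <= c * \sum_(i < N) occurs z n B i)%N.
  case PB : (P n B); last by exists 0%N.
  by have [c cP] := freq n B PB; exists c.
exists (\max_B c B)%N => B PB N0; have [N N0N NB] := cP B PB N0.
by exists N => //; apply: leq_trans NB _; rewrite leq_mul2r leq_bigmax ?orbT.
Qed.

(** If every occurrence below N met [S], then N / c would be at most the number of spoiled windows,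
    which the sparsity of [S] keeps smaller. *)
Lemma occurs_avoiding (A : finType) (z : nat -> A) n (B : n.-tuple A) c
    (S : nat -> bool) :
  (forall N0, exists2 N, (N0 <= N)%N &
     (N <= c * \sum_(i < N) occurs z n B i)%N) ->
  (forall N, ((2 * (n * c)).+1 * \sum_(y < N) S y <= N)%N) ->
  exists i, occurs z n B i && ~~ [exists x : 'I_n, S (i + x)%N].
Proof.
(* Taking N > n gives N + n < 2 N, which the factor 2 in the sparsity hypothesis absorbs. *)
move=> freq rare; have [N nN NB] := freq n.+1.
have bad := sum_windows_le S n N; have {}rare := rare (N + n)%N.
set b := (\sum_(i < N) [exists x : 'I_n, S (i + x)])%N in bad.
set s := (\sum_(y < N + n) S y)%N in bad rare.
set o := (\sum_(i < N) occurs z n B i)%N in NB.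
have lt_bo : (b < o)%N.
  rewrite ltnNge; apply/negP => ob.
  have H1 : (N <= c * (n * s))%N.
    by apply: leq_trans NB _; rewrite leq_mul2l (leq_trans ob bad) orbT.
  have H2 : (2 * (n * c * s) + s <= N + n)%N by move: rare; nia.
  have : (c * (n * s) = n * c * s)%N by rewrite mulnCA mulnA.
  lia.
have /existsP[i] : [exists i : 'I_N,
    occurs z n B i && ~~ [exists x : 'I_n, S (i + x)%N]].
  rewrite -[X in is_true X]negbK; apply/negP => /existsPn all_bad.
  move: lt_bo; rewrite ltnNge => /negP; apply; apply: leq_sum => i _.
  by have := all_bad i; case: occurs => //=; rewrite negbK => ->.
by exists i.
Qed.

(** * The Toeplitz sequence and its blocks *)

(** The three factors of the last bound count the residue of the chosen position modulo [M], the
    block of [t] read there, and the letters of B lost under the copies from smaller scales. *)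
Lemma toeplitz_approximation (A : finType) (z : nat -> A)
    (P : forall n, pred (n.-tuple A)) (K : nat) : (0 < K)%N ->
  (forall n (B : n.-tuple A), P n B -> exists c : nat, forall N0,
     exists2 N, (N0 <= N)%N & (N <= c * \sum_(i < N) occurs z n B i)%N) ->
  exists t : nat -> A,
  [/\ toeplitz t, forall N, (K * \sum_(n < N) (t n != z n) <= N)%N &
   forall m, exists2 M, (m < M)%N &
     (#|P (M * M)%N| <= M * (#|[pred B : (M * M).-tuple A |
        `[< exists i, forall j : 'I_(M * M), t (i + j)%N = tnth B j >]]| *
        #|A| ^ (M * M %/ K)))%N].
Proof.
move=> K0 /uniform_frequency[c freq].
(* The first summand makes [t] close to [z]; the second is the sparsity required by
   [occurs_avoiding] for blocks of length m * m. *)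
pose G m := (K + (2 * (m * m * c (m * m))).+1)%N.
have [M [Mgt Mdvd Mfast]] := fast_scales G.
have M0 j : (0 < M j)%N by apply: leq_ltn_trans (Mgt j).
have [f [fper fid]] := toeplitz_fold M Mgt Mdvd.
have MfastK j : (2 ^ j.+1 * K * M j <= M j.+1)%N.
  apply: leq_trans (Mfast j j (leqnn j)); rewrite leq_mul2r leq_mul2l.
  by rewrite leq_addr !orbT.
have fid_far k x : (forall j, (j < k)%N -> (M j <= x %% M j.+1)%N) ->
    ~ (exists2 j, (k <= j)%N & (M j.+1 <= x)%N && (x %% M j.+1 < M j)%N) ->
    f x = x.
  move=> near far; have [//|[j /andP[Mx xM]]] := fid x; case: far.
  exists j; last by rewrite Mx xM.
  by rewrite leqNgt; apply/negP => /near; rewrite leqNgt xM.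
exists (z \o f); split.
- move=> a; have [r r0 fr] := fper a; exists r => // k _ /=.
  by rewrite fr.
- move=> N.
  apply: leq_trans (count_far_residues M 0 K N Mgt (fun j _ => MfastK j)).
  rewrite leq_mul2l; apply/orP; right; apply: leq_sum => x _ /=.
  case: asboolP => [_|far]; first by case: (_ == _).
  by rewrite (fid_far 0%N) // eqxx.
move=> k; exists (M k) => //; set n := (M k * M k)%N.
have [->|[B0 PB0]] : #|P n| = 0%N \/ exists B0, P n B0.
- case: (pickP (P n)) => [B0 PB0|P0]; first by right; exists B0.
  by left; exact: eq_card0.
- by [].
pose S x := `[< exists2 j, (k <= j)%N &
  (M j.+1 <= x)%N && (x %% M j.+1 < M j)%N >].
have /choice[pos posP] (B : n.-tuple A) : exists i, P n B ->
    occurs z n B i && ~~ [exists x : 'I_n, S (i + x)%N].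
  case PB : (P n B); last by exists 0%N.
  have [|i iP] := occurs_avoiding A z n B (c n) S (freq n B PB);
    last by exists i.
  move=> N; apply: (@leq_trans (G (M k) * \sum_(y < N) S y)%N).
    by rewrite leq_mul2r leq_addl orbT.
  apply: count_far_residues => // j kj; exact: Mfast.
(* For an occurrence at a position congruent to r, [near r] lists the letters
   possibly overwritten by scales below k, and [corr r B] records them. *)
pose near r := [pred x : 'I_n | [exists j : 'I_k, (r + x) %% M j.+1 < M j]%N].
pose word B := [tuple z (f (pos B + x)) | x < n].
pose corr r (B : n.-tuple A) : {ffun 'I_n -> A} :=
  [ffun x => if near r x then tnth B x else z 0%N].
have Mdvdk (j : 'I_k) : (M j.+1 %| M k)%N.
  apply: (@homo_leq _ M dvdn _ _ Mdvd) => //; exact: dvdn_trans.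
have nearE (i : nat) : near (i %% M k)%N =1 near i.
  move=> x /=; apply: eq_existsb => j.
  by rewrite -modnDml modn_dvdm // modnDml.
pose L := [pred B : n.-tuple A |
        `[< exists i, forall j : 'I_n, (z \o f) (i + j)%N = tnth B j >]].
have fiber (r : 'I_(M k)) :
    (#|[pred B | P n B & pos B %% M k == r]| <= #|L| * #|A| ^ (n %/ K))%N.
  (* [z 0] is the default value outside [near r], so only the choices of letters on [near r] are
     counted. *)
  pose C := [predX L & pffun_on (z 0%N) (near r) A].
  have leC : (#|C| <= #|L| * #|A| ^ (n %/ K))%N.
    rewrite cardX card_pffun_on leq_mul2l; apply/orP; right.
    apply: leq_pexp2l; first by apply/card_gt0P; exists (z 0%N).
    rewrite leq_divRL // mulnC.
    apply: leq_trans (count_near_residues M k K r n _ _) => //.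
    - rewrite leq_mul2l; apply/orP; right.
      rewrite -sum1_card big_mkcond /=.
      rewrite -[X in (_ <= \sum_(X <= _ < _) _)%N]add0n big_addn addKn.
      rewrite big_mkord.
      by apply: leq_sum => x _; case: ifP => // /existsP[j xj];
        rewrite lt0b; apply/existsP; exists j; rewrite addnC.
    - by move=> j jk; rewrite M0 dvdn_mull //; exact: (Mdvdk (Ordinal jk)).
  apply: leq_trans leC.
  rewrite -(@card_in_imset _ _ (fun B => (word B, corr r B))).
    apply: subset_leq_card.
    apply/fintype.subsetP => _ /imsetP[B /andP[PB posB] ->].
    rewrite !inE /=; apply/andP; split.
      by apply/asboolP; exists (pos B) => j; rewrite tnth_mktuple.
    apply/pffun_onP; split => //.
    apply/fintype.subsetP => x; rewrite !inE ffunE; case: ifP => //.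
    by rewrite eqxx.
  (* Injectivity: letters on [near r] are recovered from [corr]. Elsewhere neither a near nor a far
     copy interferes, so [f] fixes the position and [word] shows the letter of B. *)
  move=> B B' /andP[PB /eqP rB] /andP[PB' /eqP rB'] /eqP;
    rewrite xpair_eqE => /andP[/eqP wBB' /eqP cBB'].
  apply: eq_from_tnth => x.
  have [nx|nx] := boolP (near r x).
    by have := congr1 (fun g : {ffun 'I_n -> A} => g x) cBB'; rewrite !ffunE nx.
  have word_tnth B1 : P n B1 -> (pos B1 %% M k)%N = r ->
      tnth (word B1) x = tnth B1 x.
    move=> PB1 rB1; rewrite tnth_mktuple.
    have /andP[/forallP/(_ x)/eqP <- /existsPn/(_ x) /asboolP far] :=
      posP B1 PB1.
    rewrite (fid_far k) // => j jk; rewrite leqNgt; apply/negP => xj.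
    move/negP: nx; apply; rewrite -rB1 nearE.
    by apply/existsP; exists (Ordinal jk).
  by rewrite -word_tnth // -[RHS]word_tnth // wBB'.
rewrite -sum1_card.
rewrite (partition_big (fun B => inord (pos B %% M k) : 'I_(M k).-1.+1)
  xpredT) //=.
have Mk : (M k).-1.+1 = M k by rewrite prednK.
rewrite -[X in (_ <= X * _)%N]Mk -[X in (_ <= X * _)%N]card_ord -sum_nat_const.
apply: leq_sum => r _; have rM : (r < M k)%N by rewrite -{2}Mk.
rewrite sum1_card; apply: leq_trans (fiber (Ordinal rM)).
apply: subset_leq_card; apply/fintype.subsetP => B.
rewrite !inE => /andP[PB /eqP rB] /=; apply/andP; split; first exact: PB.
by rewrite -rB inordK // Mk ltn_mod.
Qed.

(** * Lower limits and subadditive sequences *)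

Lemma limn_inf_gt0P (R : realType) (u : nat -> R) :
  bounded_fun (u : (R^o)^nat) ->
  0 < limn_inf u <->
  exists2 e : R, 0 < e & exists N, forall n, (N <= n)%N -> e <= u n.
Proof.
move=> bu; have lbu := bounded_fun_has_lbound bu.
rewrite limn_infE //; split=> [|[e e0 [N Ne]]].
- move=> /sup_gt; case; first by exists (infs u 0%N); exists 0%N.
  move=> _ [N _ <-] e0; exists (infs u N) => //; exists N => n Nn.
  by apply: ge_inf; [exact/has_lbound_sdrop|exists n].
- apply: lt_le_trans e0 _; apply: (@le_trans _ _ (infs u N)).
    apply: lb_le_inf => [|_ [n Nn <-]]; last exact: Ne.
    by exists (u N); exists N => /=.
  by apply: ub_le_sup; [exact: bounded_fun_has_ubound_infs|exists N].
Qed.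

(** Fekete's lemma: the limit is the infimum of the quotients. Dividing n by a nearly optimal m
    leaves an error bounded independently of n. *)
Lemma fekete (R : realType) (a : nat -> R) : (forall n, 0 <= a n) ->
  (forall m n, a (m + n)%N <= a m + a n) -> cvgn (fun n => a n / n%:R).
Proof.
(* The index [n.+1] leaves out n = 0, whose quotient is 0 by convention and would force the infimum
   to be 0. *)
move=> a0 sub; pose E := [set a n.+1 / n.+1%:R | n in [set: nat]].
have lbE : has_lbound E.
  by exists 0 => _ [n _ <-]; rewrite divr_ge0.
apply/cvg_ex; exists (inf E); apply/cvgrPdist_lt => e e0.
have [||_ [m' _ <-] mlt] := @inf_lt _ E (inf E + e / 2).
- by exists (a 1%N / 1%:R); exists 0%N.
- by rewrite ltrDl divr_gt0.
move: mlt; set m := m'.+1 => mlt.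
(* Bounds [a] at all remainders modulo m at once, by nonnegativity. *)
pose c := \sum_(r < m) a r.
have c0 : 0 <= c by apply: sumr_ge0.
have amul q : a (q * m)%N <= q%:R * a m + a 0%N.
  elim: q => [|q IH]; first by rewrite mul0r add0r.
  rewrite mulSn; apply: le_trans (sub _ _) _.
  by rewrite -natr1 mulrDl mul1r addrAC [leRHS]addrC lerD2l.
near=> n.
have n0 : (0 < n)%N by near: n; exists 1%N.
have nR : (0 : R) < n%:R by rewrite ltr0n.
have inf_le : inf E <= a n / n%:R.
  by apply: ge_inf => //; exists n.-1 => //; rewrite prednK.
rewrite distrC ger0_norm ?subr_ge0 // ltrBlDl.
have ale : a n <= n%:R * (a m / m%:R) + (a 0%N + c).
  rewrite [in leLHS](divn_eq n m); apply: le_trans (sub _ _) _.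
  rewrite addrA; apply: lerD.
    apply: le_trans (amul _) _; rewrite lerD2r mulrCA [leRHS]mulrC.
    rewrite ler_wpM2r // ler_pdivlMr ?ltr0n // -natrM ler_nat.
    exact: leq_trunc_div.
  rewrite /c (bigD1 (Ordinal (ltn_pmod n (ltn0Sn m')))) //= lerDl.
  exact: sumr_ge0.
apply: (@le_lt_trans _ _ (a m / m%:R + (a 0%N + c) / n%:R)).
  rewrite ler_pdivrMr // mulrDl divfK ?gt_eqF // [a m / _ * _]mulrC.
  exact: ale.
have cn : (a 0%N + c) / n%:R <= e / 2.
  rewrite ler_pdivrMr // mulrC -ler_pdivrMr ?divr_gt0 //.
  near: n; exact: nbhs_infty_ger.
lra.
Unshelve. all: by end_near.
Qed.

(** * Cylinders and frequencies along a quasi-generic point *)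

Lemma near_prefix (w : sgnseq) n :
  \forall v \near w, forall i : 'I_n, (v : sgnseq) i = w i.
Proof.
have near1 (i : 'I_n) : \forall v \near w, (v : sgnseq) i = w i.
  by have := @proj_continuous nat (fun=> sgn) i w; move/discrete_cvg.
exact: (@filter_forall _ _ _ _ (nbhs_filter w) near1).
Qed.

Lemma open_cylinder n (B : n.-tuple sgn) : open (cylinder B : set sgnseq).
Proof.
rewrite openE => w /= wB; near=> v => i /=; rewrite -wB; move: i.
by near: v; exact: near_prefix.
Unshelve. all: by end_near.
Qed.

Lemma measurable_cylinder n (B : n.-tuple sgn) : measurable (cylinder B).
Proof. by apply: sub_sigma_algebra; exact: open_cylinder. Qed.

(** Cylinders are clopen, so weak convergence can be tested on their indicators. *)
Lemma continuous_indic_cylinder (R : realType) n (B : n.-tuple sgn) :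
  continuous (\1_(cylinder B) : sgnseq -> R).
Proof.
move=> w; apply: cvg_near_cst; near=> v.
have vw : forall i : 'I_n, v i = w i by near: v; exact: near_prefix.
rewrite !indicE; congr (_%:R); congr (nat_of_bool _).
by apply/idP/idP => /set_mem vB; apply/mem_set => i; rewrite -vB ?vw.
Unshelve. all: by end_near.
Qed.

Lemma Rintegral_indic_cylinder (R : realType)
    (mu : {measure set borel_sgnseq -> \bar R}) n (B : n.-tuple sgn) :
  Rintegral mu setT (\1_(cylinder B)) = fine (mu (cylinder B)).
Proof.
rewrite /Rintegral integral_indic ?setIT //; exact: measurable_cylinder.
Qed.

Lemma iter_shiftE k (w : sgnseq) i : iter k shift w i = w (i + k)%N.
Proof.
elim: k i => [|k IH] i; first by rewrite addn0.
by rewrite iterS /shift IH addSnnS.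
Qed.

(** The offset [i.+1] appears because the orbit average starts at the first shift of [z], not at [z]
    itself. *)
Lemma empirical_cylinder (R : realType) (z : sgnseq) N n (B : n.-tuple sgn) :
  empirical (R := R) z N (cylinder B) =
  (N%:R^-1 * (\sum_(i < N) occurs z n B i.+1)%N%:R)%:E.
Proof.
rewrite /empirical /mscale /= /msum EFinM; congr (_ * _)%E.
rewrite natr_sum -sumEFin; apply: eq_bigr => i _.
rewrite -[LHS]/(\d_(iter i.+1 shift z : borel_sgnseq) (cylinder B)).
rewrite diracE.
congr ((_)%:R%:E); congr (nat_of_bool _).
apply/idP/forallP => [/set_mem zB j|zB].
  by rewrite -zB -[X in _ == X]/(iter i.+1 shift z j) iter_shiftE addnC.
apply/mem_set => j; rewrite -[LHS]/(iter i.+1 shift z j) iter_shiftE.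
by rewrite addnC; exact/eqP.
Qed.

Lemma quasi_generic_frequency (R : realType) (z : sgnseq)
    (nu : probability borel_sgnseq R) n (B : n.-tuple sgn) :
  quasi_generic z nu -> (0 < nu (cylinder B))%E ->
  exists c : nat, forall N0, exists2 N, (N0 <= N)%N &
    (N <= c * \sum_(i < N) occurs z n B i)%N.
Proof.
move=> [Nk [Nincr /(_ _ (@continuous_indic_cylinder R n B))]].
rewrite Rintegral_indic_cylinder.
under eq_fun do rewrite Rintegral_indic_cylinder empirical_cylinder /=.
set p := fine _ => cvgp nuB.
have p0 : 0 < p.
  apply: fine_gt0; rewrite nuB /=.
  exact: le_lt_trans (probability_le1 nu (measurable_cylinder n B)) (ltry _).
pose c := (Num.truncn (2 / p)).+1.
have pc : 2 / p < c%:R by exact: truncnS_gt.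
(* Since c > 2 / p, frequency above p / 2 gives N at most c times the number of occurrences at 1,
   ..., N. Counting from 0 needs length N + 1, and the factor 2 pays for it. *)
exists (2 * c)%N => N0.
have [k [kN0 kp]] : exists k, (N0 < Nk k)%N /\
    p / 2 < (Nk k)%:R^-1 * (\sum_(i < Nk k) occurs z n B i.+1)%N%:R.
  near \oo => k; exists k; split.
    have kNk : (k <= Nk k)%N.
      by elim: (k) => // k' IH; apply: leq_ltn_trans IH _; exact: Nincr.
    by apply: leq_trans kNk; near: k; exact: nbhs_infty_gt.
  near: k; apply: (cvgr_gt _ cvgp); lra.
move: kp kN0; set N := Nk k => kp kN0.
exists N.+1; first exact: leqW (ltnW kN0).
have N0' : (0 : R) < N%:R by rewrite ltr0n; apply: leq_ltn_trans kN0.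
have occ_le : (\sum_(i < N) occurs z n B i.+1 <=
    \sum_(i < N.+1) occurs z n B i)%N.
  by rewrite big_ord_recl leq_addl.
apply: (@leq_trans (2 * N)); first by rewrite mul2n -addnn; lia.
rewrite -mulnA leq_mul2l /=.
apply: (@leq_trans (c * \sum_(i < N) occurs z n B i.+1));
  last by rewrite leq_mul2l occ_le orbT.
rewrite -(ler_nat R) natrM; set s := (\sum_(i < N) _)%N%:R in kp *.
move: kp; rewrite [_^-1 * s]mulrC ltr_pdivlMr // => kp.
have cp : 2 < c%:R * p by rewrite -ltr_pdivrMr.
have s0 : 0 <= s by rewrite ler0n.
have : (0:R) <= c%:R by [].
nra.
Unshelve. all: by end_near.
Qed.

(** * Logarithms and entropy as a limit *)

Lemma log2_nat_ge0 (R : realType) n : 0 <= log2 (n%:R : R).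
Proof.
case: n => [|n]; first by rewrite /log2 ln0 // mul0r.
by rewrite /log2 divr_ge0 // ln_ge0 // ler1n.
Qed.

Lemma ler_log2_nat (R : realType) m n : (0 < n)%N -> (m <= n)%N ->
  log2 (m%:R : R) <= log2 n%:R.
Proof.
case: m => [|m] n0 mn; first by rewrite /log2 ln0 // mul0r; exact: log2_nat_ge0.
rewrite /log2 ler_pM2r ?invr_gt0 ?ln_gt0 ?ltr1n //.
by rewrite ler_ln ?posrE ?ltr0n // ler_nat.
Qed.

Lemma log2_natM (R : realType) m n : (0 < m)%N -> (0 < n)%N ->
  log2 ((m * n)%N%:R : R) = log2 m%:R + log2 n%:R.
Proof.
by move=> m0 n0; rewrite /log2 natrM lnM ?posrE ?ltr0n // mulrDl.
Qed.

Lemma log2_exp2 (R : realType) n : log2 ((2 ^ n)%N%:R : R) = n%:R.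
Proof.
rewrite /log2 natrX lnXn // -[_ *+ n]mulr_natl mulfK //.
by rewrite gt_eqF // ln_gt0 // ltr1n.
Qed.

Lemma complexity_gt0 (w : sgnseq) n : (0 < complexity w n)%N.
Proof.
rewrite /complexity (cardD1 [tuple w i | i < n]) inE asboolT //.
by exists 0%N => j; rewrite tnth_mktuple.
Qed.

Lemma complexityD (w : sgnseq) m n :
  (complexity w (m + n) <= complexity w m * complexity w n)%N.
Proof.
rewrite /complexity -cardX.
pose split (B : (m + n).-tuple sgn) :=
  ([tuple tnth B (lshift n j) | j < m], [tuple tnth B (rshift m j) | j < n]).
rewrite -(@card_imset _ _ split).
  apply: subset_leq_card.
  apply/fintype.subsetP => _ /imsetP[B /asboolP[i iB] ->].
  rewrite !inE /=; apply/andP; split; apply/asboolP.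
    by exists i => j; rewrite tnth_mktuple -iB.
  by exists (i + m)%N => j; rewrite tnth_mktuple -iB /= addnA.
move=> B B' /eqP; rewrite xpair_eqE => /andP[/eqP eql /eqP eqr].
apply: eq_from_tnth => x; case: (split_ordP x) => j ->.
  by have := congr1 (fun t => tnth t j) eql; rewrite !tnth_mktuple.
by have := congr1 (fun t => tnth t j) eqr; rewrite !tnth_mktuple.
Qed.

(** Submultiplicativity of the complexity makes its logarithm subadditive, so the [limn] defining
    [htop] is a genuine limit. *)
Lemma cvg_htop (R : realType) (w : sgnseq) :
  log2 (complexity w n)%:R / n%:R @[n --> \oo] --> htop R w.
Proof.
apply: (@fekete R (fun n => log2 (complexity w n)%:R)) => [n|m n].
  exact: log2_nat_ge0.
rewrite -log2_natM ?complexity_gt0 //; apply: ler_log2_nat (complexityD w m n).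
by rewrite muln_gt0 !complexity_gt0.
Qed.

Lemma cvg_htop_supp (R : realType) (nu : probability borel_sgnseq R) :
  0 < htop_supp nu ->
  log2 #|[pred B : n.-tuple sgn | (0 < nu (cylinder B))%E]|%:R / n%:R
    @[n --> \oo] --> htop_supp nu.
Proof.
(* [limn] of a divergent sequence is the junk value 0. *)
move=> H0; apply: contrapT => dvg; move: H0.
have -> : htop_supp nu = 0 := dvg_inP _ dvg.
by rewrite ltxx.
Qed.

Lemma card_sgn : #|{: sgn}| = 3.
Proof. by rewrite card_seq_sub. Qed.

(** * Correlation with a nearby sequence *)

Lemma normr_sgnR (R : realType) (a : sgn) : `|sgnR a : R| <= 1.
Proof.
rewrite /sgnR; case: a => a /=; rewrite !inE => /or3P[] /eqP -> //=.
- by rewrite normrN normr1.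
- by rewrite normr0.
- by rewrite normr1.
Qed.

Lemma bounded_average (R : realType) (u : nat -> R) :
  (forall n, `|u n| <= 1) ->
  bounded_fun ((fun N => (\sum_(n < N) u n) / N%:R) : (R^o)^nat).
Proof.
move=> u1; exists 1; split; first exact: num_real.
move=> x x1 N _; apply: le_trans (ltW x1).
rewrite normrM normfV [`|N%:R|]ger0_norm //.
case: N => [|N]; first by rewrite invr0 mulr0.
rewrite ler_pdivrMr ?ltr0n // mul1r.
apply: le_trans (ler_norm_sum _ _ _) _.
apply: (@le_trans _ _ (\sum_(i < N.+1) 1)).
  by apply: ler_sum => i _; exact: u1.
by rewrite sumr_const card_ord.
Qed.

Lemma sgnR_mul_ge (R : realType) (a b : sgn) :
  (sgnR b : R) ^+ 2 - 2 * (a != b)%:R <= sgnR a * sgnR b.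
Proof.
case: eqVneq => [->|_] /=; first by rewrite mulr0 subr0 expr2.
have := @normr_sgnR R a; have := @normr_sgnR R b.
rewrite !ler_norml => /andP[b1 b2] /andP[a1 a2]; nra.
Qed.

(** Each disagreement costs at most 2, and their density is at most 1 / K < e / 4, so at least e / 2
    of the average of z^2 survives. *)
Lemma correlation_gt0 (R : realType) (z t : sgnseq) (K : nat) (e : R) N0 :
  0 < e -> 4 / e < K%:R ->
  (forall N, (N0 <= N)%N -> e <= (\sum_(n < N) (sgnR (z n) : R) ^+ 2) / N%:R) ->
  (forall N, (K * \sum_(n < N) (t n != z n) <= N)%N) ->
  0 < limn_inf (fun N : nat =>
    (\sum_(n < N) (sgnR (t n) * sgnR (z n) : R)) / N%:R).
Proof.
move=> e0 eK ez few; apply/limn_inf_gt0P.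
  apply: (@bounded_average R (fun n => sgnR (t n) * sgnR (z n))) => n.
  rewrite normrM -[leRHS]mulr1.
  by rewrite ler_pM // normr_sgnR.
exists (e / 2); first by rewrite divr_gt0.
exists N0.+1 => N NN.
have N1 : (0 : R) < N%:R by rewrite ltr0n; apply: leq_trans NN.
have := ez N (ltnW NN); have := few N; rewrite -(ler_nat R) natrM natr_sum.
set s := \sum_(n < N) _; set s2 := \sum_(n < N) _ => fewN.
rewrite !ler_pdivlMr // => es2.
have : s2 - 2 * s <= \sum_(n < N) (sgnR (t n) * sgnR (z n) : R).
  rewrite /s /s2 big_distrr /= -sumrB; apply: ler_sum => n _.
  exact: sgnR_mul_ge.
apply: le_trans; move: eK; rewrite ltr_pdivrMr // => eK.
have s0 : 0 <= s by apply: sumr_ge0 => i _; rewrite ler0n.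
have : 4 * s <= e * N%:R by nra.
lra.
Qed.

(** * Choice of constants and the entropy estimate *)

Theorem theorem7p1 (R : realType) (z : sgnseq)
    (nu : probability borel_sgnseq R) (q b : nat) :
  0 < limn_inf (fun N : nat =>
        (\sum_(n < N) (sgnR (z n) : R) ^+ 2) / N%:R) ->
  invariant_measure shift nu ->
  quasi_generic z nu ->
  0 < htop_supp nu ->
  (2 <= q)%N -> (1 <= b)%N ->
  (forall m : nat, (1 <= m)%N ->
     exists2 k : nat, (k <= b)%N &
       has_ergodic_components (iter (q ^ m)%N shift) nu k) ->
  forall eps : R, 0 < eps ->
  exists t : sgnseq,
    [/\ toeplitz t,
        (1 - eps) * htop_supp nu <= htop R t &
        0 < limn_inf (fun N : nat =>
              (\sum_(n < N) (sgnR (t n) * sgnR (z n) : R)) / N%:R)].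
Proof.
move=> z_supp _ zgen H0 _ _ _ eps eps0.
have /limn_inf_gt0P[|e e0 [N0 ez]] := z_supp.
  apply: (@bounded_average R (fun n => sgnR (z n) ^+ 2)) => n.
  by rewrite normrX expr_le1 // normr_sgnR.
set H := htop_supp nu in H0 *; pose d := eps * H.
have d0 : 0 < d by rewrite mulr_gt0.
(* The term 4 / e serves the correlation; 8 / d keeps the entropy of the lost letters, at most 2 / K
   per position, below d / 4. *)
pose K := (Num.truncn (4 / e + 8 / d)).+1.
have Kgt : 4 / e + 8 / d < K%:R by exact: truncnS_gt.
have e4 : 0 < 4 / e by rewrite divr_gt0.
have d8 : 0 < 8 / d by rewrite divr_gt0.
have [//|n B nuB|t [tT few tH]] := @toeplitz_approximation _ z
  (fun n => [pred B : n.-tuple sgn | (0 < nu (cylinder B))%E]) K.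
  exact: quasi_generic_frequency zgen nuB.
exists t; split=> //; last first.
  by apply: correlation_gt0 ez few => //; lra.
set h := htop R t.
have ltH : H - d / 4 < H by rewrite ltrBlDr ltrDl divr_gt0.
have lth : h < h + d / 4 by rewrite ltrDl divr_gt0.
(* The allowed loss d is split in four: one quarter for each of the two entropy limits, one for the
   residues and one for the lost letters. *)
have [N1 _ N1P] := cvgr_gt _ (cvg_htop_supp R nu H0) (H - d / 4) ltH.
have [N2 _ N2P] := cvgr_lt _ (cvg_htop R t) (h + d / 4) lth.
pose N3 := Num.truncn (4 / d).
have [M MN cardP] := tH (N1 + N2 + N3)%N.
have M0 : (0 < M)%N by apply: leq_ltn_trans MN.
have MMM : (M <= M * M)%N by rewrite leq_pmulr.
set n := (M * M)%N in MMM cardP.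
have n0 : (0 : R) < n%:R by rewrite ltr0n muln_gt0 M0.
have N12 : (N1 + N2 <= n)%N.
  by rewrite (leq_trans _ MMM) // ltnW // (leq_ltn_trans _ MN) // leq_addr.
have := N1P n (leq_trans (leq_addr _ _) N12).
have := N2P n (leq_trans (leq_addl _ _) N12).
rewrite ltr_pdivlMr // ltr_pdivrMr // -/(complexity t n) in cardP *.
set p := complexity t n in cardP * => pn Pn.
have p0 : (0 < p)%N by exact: complexity_gt0.
have := cardP; rewrite card_sgn => {}cardP.
(* The crude bounds M <= 2^M and 3 <= 2^2 suffice: with n = M^2, the residues cost M / n = 1 / M < d
   / 4 per position. *)
have {}cardP : (#|[pred B : n.-tuple sgn | (0 < nu (cylinder B))%E]| <=
    2 ^ M * (p * 2 ^ (2 * (n %/ K))))%N.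
  apply: leq_trans cardP _; apply: leq_mul; first exact/ltnW/ltn_expl.
  by rewrite leq_mul // expnM; case: (n %/ K)%N => // k; rewrite leq_exp2r.
have := @ler_log2_nat R _ _ _ cardP.
rewrite !log2_natM ?log2_exp2 ?muln_gt0 ?expn_gt0 ?p0 // => /(_ isT) logP.
have nK : (n %/ K)%:R * K%:R <= n%:R :> R.
  by rewrite -natrM ler_nat leq_trunc_div.
have Md : 4 / d < M%:R.
  apply: lt_le_trans (truncnS_gt _) _; rewrite ler_nat.
  exact: leq_ltn_trans (leq_addl _ _) MN.
move: Md; rewrite ltr_pdivrMr // => Md.
have nE : n%:R = M%:R * M%:R :> R by rewrite natrM.
have MR : (0 : R) < M%:R by rewrite ltr0n.
have Mle : 4 * M%:R <= d * n%:R by rewrite nE; nra.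
have Kd : 8 < K%:R * d by rewrite -ltr_pdivrMr //; lra.
have q0 : (0 : R) <= (n %/ K)%:R by [].
have nKd : 8 * (n %/ K)%:R <= d * n%:R by nra.
move: logP; rewrite natrM => logP.
have : (H - d) * n%:R <= h * n%:R by lra.
by rewrite ler_pM2r // mulrBl mul1r.
Qed.
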